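(* Let $H=(\mathcal{V},\mathcal{E})$ be a hypergraph. Let $\chi_{min}(H)=\min_t \chi(\Gamma_t)$, the minimum chromatic number over all co-occurrence graphs $\Gamma_t$ of $H$, where $t$ ranges over all functions $t:\mathcal{E}\to\mathcal{V}$ with $t(e)\in e$ for every $e\in\mathcal{E}$. Then $\chi_{cf}(H)=\chi_{min}(H)$.
   Context: A hypergraph $H=(\mathcal{V},\mathcal{E})$ has a finite vertex set $\mathcal{V}$ and a family $\mathcal{E}$ of nonempty subsets of $\mathcal{V}$. A function $C:\mathcal{V}\to\{0,1,\dots,k\}$ is a conflict-free (CF) colouring of $H$ with $k$ non-zero colours if for every $e\in\mathcal{E}$ there is a non-zero colour $j$ with $|e\cap C^{-1}(j)|=1$; $\chi_{cf}(H)$ is the minimum such $k$. For a function $t:\mathcal{E}\to\mathcal{V}$ with $t(e)\in e$ for all $e$ (a representative function), let $R=t(\mathcal{E})$ be its image; the co-occurrence graph $\Gamma_t$ is the simple graph with vertex set $R$ in which distinct $u,v\in R$ are adjacent if and only if there is some $e\in\mathcal{E}$ with $u\in e$, $v\in e$ and $t(e)\in\{u,v\}$. $\chi(\cdot)$ denotes the chromatic number. *)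

(* Defs.v *)
From mathcomp Require Import all_boot.

Set Implicit Arguments.
Unset Strict Implicit.
Unset Printing Implicit Defensive.

Record simple_graph := SimpleGraph {
  gvert : finType;
  gadj : rel gvert;
  gadj_sym : symmetric gadj;
  gadj_irrefl : irreflexive gadj
}.

Definition proper_colouring (G : simple_graph) (k : nat)
    (c : {ffun gvert G -> 'I_k}) : bool :=
  [forall u, forall v, gadj u v ==> (c u != c v)].

Definition colourable (G : simple_graph) (k : nat) : bool :=
  [exists c : {ffun gvert G -> 'I_k}, proper_colouring c].

Lemma colourable_ex (G : simple_graph) : exists k, colourable G k.
Proof.
exists #|gvert G|; apply/existsP; exists [ffun v => enum_rank v].
apply/forallP=> u; apply/forallP=> v; apply/implyP=> uv; rewrite !ffunE.
by apply: contraTneq uv => /enum_rank_inj ->; rewrite gadj_irrefl.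
Qed.

Definition chromatic_number (G : simple_graph) : nat := ex_minn (colourable_ex G).

Record hypergraph (V : finType) := Hypergraph {
  hedges : {set {set V}};
  hedges_neq0 : set0 \notin hedges
}.

Section Hypergraph.

Variables (V : finType) (H : hypergraph V).

(* The colour 0 of 'I_k.+1 is the neutral colour; the k others are non-zero. *)
Definition cf_colouring (k : nat) (C : {ffun V -> 'I_k.+1}) : bool :=
  [forall e in hedges H,
     exists j : 'I_k.+1, (j != ord0) && (#|e :&: C @^-1: [set j]| == 1)].

Definition cf_colourable (k : nat) : bool :=
  [exists C : {ffun V -> 'I_k.+1}, cf_colouring C].

Lemma cf_colourable_ex : exists k, cf_colourable k.
Proof.
exists #|V|; apply/existsP; exists [ffun v => lift ord0 (enum_rank v)].
apply/forall_inP=> e eH.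
have /set0Pn[v ve] : e != set0 by apply: contraNneq (hedges_neq0 H) => <-.
apply/existsP; exists (lift ord0 (enum_rank v)); rewrite eq_sym neq_lift /=.
apply/cards1P; exists v; apply/setP=> w; rewrite !inE ffunE.
apply/andP/eqP=> [[_ /eqP/lift_inj/enum_rank_inj]|->] //.
Qed.

Definition chi_cf : nat := ex_minn cf_colourable_ex.

Definition hedge : finType := {e : {set V} | e \in hedges H}.

Definition is_representative (t : {ffun hedge -> V}) : bool :=
  [forall e : hedge, t e \in val e].

Definition rep_fun : finType := {t : {ffun hedge -> V} | is_representative t}.

Section CoOccurrence.

Variable t : rep_fun.

Definition rep_image : {set V} := [set val t e | e : hedge].

Definition co_vert : finType := {v : V | v \in rep_image}.

Definition co_adj : rel co_vert := fun u v =>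
  (u != v) &&
  [exists e : hedge, [&& val u \in val e, val v \in val e
                       & val t e \in [set val u; val v]]].

Lemma co_adj_sym : symmetric co_adj.
Proof.
move=> u v; rewrite /co_adj eq_sym; congr (_ && _).
by apply: eq_existsb => e; rewrite andbCA setUC.
Qed.

Lemma co_adj_irrefl : irreflexive co_adj.
Proof. by move=> u; rewrite /co_adj eqxx. Qed.

Definition co_occurrence_graph : simple_graph :=
  SimpleGraph co_adj_sym co_adj_irrefl.

End CoOccurrence.

Lemma chi_min_ex :
  exists n, [exists t : rep_fun, chromatic_number (co_occurrence_graph t) == n].
Proof.
have e0 (e : hedge) : exists v, v \in val e.
  by apply/set0Pn; apply: contraNneq (hedges_neq0 H) => <-; apply: valP.
have tP : is_representative [ffun e => xchoose (e0 e)].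
  by apply/forallP=> e; rewrite ffunE; apply: xchooseP.
pose t : rep_fun := exist (fun t => is_representative t) _ tP.
by exists (chromatic_number (co_occurrence_graph t)); apply/existsP; exists t.
Qed.

Definition chi_min : nat := ex_minn chi_min_ex.

End Hypergraph.

(* Main.v *)
(** A conflict-free colouring yields a representative function [t] by sending
    each edge to a vertex whose non-zero colour is unique in that edge; the
    colouring is then proper on [Gamma_t]. Conversely a proper colouring of
    [Gamma_t], extended by the neutral colour outside the image of [t], makes
    the colour of [t e] unique in [e]. Hence [k] colours suffice for [H] if and
    only if they suffice for some [Gamma_t]. *)
Require Import Defs.
From mathcomp Require Import all_boot.

Set Implicit Arguments.
Unset Strict Implicit.
Unset Printing Implicit Defensive.

(** The edge [e] itself witnesses the adjacency, its representative being one endpoint. *)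
Lemma co_adj_rep (V : finType) (H : hypergraph V) (t : rep_fun H) (e : hedge H)
    (u v : co_vert t) :
  val u = val t e -> val v \in val e -> val v != val u -> co_adj u v.
Proof.
move=> ute ve neq; apply/andP; split; first by rewrite eq_sym.
apply/existsP; exists e; rewrite ve ute !inE eqxx /= andbT.
exact: (forallP (valP t)).
Qed.

Lemma cf_colourable_co_occurrence (V : finType) (H : hypergraph V) (k : nat) :
  cf_colourable H k -> exists t : rep_fun H, colourable (co_occurrence_graph t) k.
Proof.
case/existsP=> C /forall_inP cfC.
have witness (e : hedge H) : exists v, [/\ v \in val e, C v != ord0 &
    forall w, w \in val e -> C w = C v -> w = v].
  have /existsP[j /andP[j0 /cards1P[v ev]]] := cfC _ (valP e).
  have mem_jE w : (w \in val e) && (C w == j) = (w == v).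
    by have /setP/(_ w) := ev; rewrite !inE.
  have /andP[ve /eqP Cv] : (v \in val e) && (C v == j) by rewrite mem_jE.
  exists v; split; rewrite ?Cv // => w we Cw.
  by apply/eqP; rewrite -mem_jE we Cw eqxx.
have [f fP] := fin_all_exists witness.
have tP : is_representative [ffun e => f e].
  by apply/forallP=> e; rewrite ffunE; case: (fP e).
pose t : rep_fun H := exist (fun t => is_representative t) _ tP.
(* Vertices of the graph are representatives, hence never neutral: dropping colour 0 leaves [k]
   colours, not [k.+1]. *)
have shift (u : co_vert t) : exists i : 'I_k, C (val u) = lift ord0 i.
  have /imsetP[e _ ->] := valP u; rewrite /= ffunE.
  have [_ C0 _] := fP e.
  have : ord0 != C (f e) by rewrite eq_sym.
  by case/unlift_some => i -> _; exists i.
have [c cP] := fin_all_exists shift.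
have rep_uniq (e : hedge H) (v w : co_vert t) : val v = val t e -> val w \in val e ->
    c v = c w -> v = w.
  move=> vE we cvw; have [_ _ uniq_v] := fP e.
  apply/val_inj/esym; rewrite vE /= ffunE; apply: uniq_v => //.
  by rewrite cP -cvw -cP vE /= ffunE.
exists t; apply/existsP; exists [ffun u => c u].
apply/forallP=> u; apply/forallP=> v; apply/implyP; rewrite !ffunE.
(* By contraposition: if [u] and [v] share a colour, neither can represent [e], since [rep_uniq]
   would force [u = v]. *)
case/andP=> neq /existsP[e /and3P[ue ve]]; apply: contraTN => /eqP cuv.
rewrite !inE; apply/norP; split; apply: contraNN neq => /eqP tE; apply/eqP.
  exact: rep_uniq (esym tE) ve cuv.
exact/esym/(rep_uniq _ _ _ (esym tE) ue)/esym.
Qed.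

Lemma co_occurrence_cf_colourable (V : finType) (H : hypergraph V)
    (t : rep_fun H) (k : nat) :
  colourable (co_occurrence_graph t) k -> cf_colourable H k.
Proof.
case/existsP=> c /forallP cP.
pose C v := if insub v is Some u then lift ord0 (c u) else ord0 : 'I_k.+1.
apply/existsP; exists [ffun v => C v]; apply/forall_inP=> e eH.
pose e' : hedge H := exist (fun e => e \in hedges H) e eH.
have tR : val t e' \in rep_image t by apply: imset_f.
pose u : co_vert t := exist (fun v => v \in rep_image t) _ tR.
have Cu : C (val t e') = lift ord0 (c u).
  by rewrite /C (insubT (fun v => v \in rep_image t) tR).
apply/existsP; exists (lift ord0 (c u)); rewrite eq_sym neq_lift /=.
apply/cards1P; exists (val t e'); apply/setP=> w; rewrite !inE ffunE.
apply/andP/eqP=> [[we]|->]; last first.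
  by rewrite Cu; split=> //; apply: (forallP (valP t) e').
(* Outside the image of [t], [w] is neutral and cannot match a lifted colour. Inside it, a [w] other
   than [t e'] would be a neighbour of [u] with the same colour. *)
rewrite /C; case: insubP => [v _ vw|_]; last by rewrite (negPf (neq_lift _ _)).
rewrite (inj_eq (@lift_inj _ _)) => /eqP cvu.
apply/eqP; apply: contraT => neq.
have adj : co_adj u v by apply: (@co_adj_rep _ _ _ e'); rewrite // vw.
by have /forallP/(_ v)/implyP/(_ adj) := cP u; rewrite cvu eqxx.
Qed.

Theorem theorem4 (V : finType) (H : hypergraph V) : chi_cf H = chi_min H.
Proof.
rewrite /chi_cf /chi_min.
case: ex_minnP => m cf_m min_m; case: ex_minnP => n /existsP[t /eqP tn] min_n.
apply/eqP; rewrite eqn_leq; apply/andP; split.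
  apply/min_m/(@co_occurrence_cf_colourable _ _ t).
  by rewrite -tn /chromatic_number; case: ex_minnP.
have [s col_s] := cf_colourable_co_occurrence cf_m.
(* The function [s] need not attain the minimum [n]; its chromatic number only lies between [n] and
   [m]. *)
apply: (@leq_trans (chromatic_number (co_occurrence_graph s))).
  by apply: min_n; apply/existsP; exists s.
by rewrite /chromatic_number; case: ex_minnP => p _; apply.
Qed.
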